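(* For each (small) $\varepsilon>0$ let $w^\varepsilon,z^\varepsilon:\Omega\to\mathbb{R}^d$ be smooth solutions of $$f(w^\varepsilon)_x+S(w^\varepsilon)=\varepsilon w^\varepsilon_{xx}\quad\text{and}\quad -f'(w^\varepsilon)^T z^\varepsilon_x+S'(w^\varepsilon)^T z^\varepsilon=\varepsilon z^\varepsilon_{xx}+p'(w^\varepsilon)\quad\text{on }\Omega,$$ respectively, and assume that outside a transition region $[\alpha^-,\alpha^+]$ both $z^\varepsilon_x$ and $w^\varepsilon_x$ have orders of magnitude independent of $\varepsilon$, i.e. there is a constant $C$ independent of $\varepsilon$ with $|w^\varepsilon_x(x)|\le C$ and $|z^\varepsilon_x(x)|\le C$ for all $x\in\Omega\setminus[\alpha^-,\alpha^+]$. Let $w$ be the exact solution of $f(w)_x+S(w)=0$ with a discontinuity at $x=\alpha$, and let $z$ be the corresponding adjoint solution, i.e. $-f'(w)^Tz_x+S'(w)^Tz=p'(w)$, with $z$ Lipschitz-continuous at $x=\alpha$. Assume that, as $\varepsilon\to0^+$, $w^\varepsilon$ and $z^\varepsilon$ converge pointwise to $w$ and $z$, respectively. Then $z$ fulfills the interior boundary condition with respect to $p$ and the shock position $\alpha$: $$z^T(\alpha)\,[f(w)_x]=-[p(w)] .$$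
   Context: $\Omega=[0,1]$; $f,S:\mathbb{R}^d\to\mathbb{R}^d$ and $p:\mathbb{R}^d\to\mathbb{R}$ are given smooth functions; $\alpha\in(0,1)$ is fixed. The transition region is $[\alpha^-,\alpha^+]:=[\alpha-\overline\alpha,\alpha+\overline\alpha]$, where $\overline\alpha=\overline\alpha(\varepsilon)>0$ tends to $0$ as $\varepsilon\to0^+$; inside it the gradient of $w^\varepsilon$ may be as large as order $1/\varepsilon$. No particular boundary conditions are relevant. The function $w$ is piecewise smooth: it is discontinuous at $x=\alpha$ and its restrictions to $[0,\alpha)$ and $(\alpha,1]$ extend smoothly to $[0,\alpha]$ and $[\alpha,1]$. Exact solution means that $f(w)_x+S(w)=0$ holds pointwise away from $\alpha$ and the Rankine-Hugoniot condition $f(w(\alpha))^+-f(w(\alpha))^-=0$ holds, where $\pm$ denotes the one-sided limit from the right/left. The adjoint equation is understood away from $\alpha$. In the conclusion, $[g]:=g(\alpha)^+-g(\alpha)^-$ is the jump across $x=\alpha$. Pointwise convergence of $w^\varepsilon$ is understood at all $x\in\Omega\setminus\{\alpha\}$. *)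

(* Defs.v *)
From HB Require Import structures.
From mathcomp Require Import all_boot all_order all_algebra.
From mathcomp Require Import all_classical all_reals all_analysis.

Set Implicit Arguments.
Unset Strict Implicit.
Unset Printing Implicit Defensive.
Import Order.TTheory GRing.Theory Num.Theory.
Import numFieldNormedType.Exports.
Local Open Scope classical_set_scope.
Local Open Scope ring_scope.

Definition Omega {R : realType} : set R := `[0, 1]%classic.

(* A function defined only on A (an interval) is represented by a total
   function on R. derive_on A g x is its derivative at x as a function on A:
   the two-sided derivative at an interior point of A, the one-sided one at an
   endpoint; it does not depend on the values of g outside A when x \in A. *)
Section derivative_on_a_set.
Context {R : realType} {V : normedModType R}.
Implicit Types (A : set R) (g : R -> V) (x : R).

Definition quotient g x : R -> V := fun y => (y - x)^-1 *: (g y - g x).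

Definition derivable_on A g x := cvg (quotient g x @ within A x^').

Definition derive_on A g x : V := lim (quotient g x @ within A x^').

Definition smooth_on A g :=
  forall (n : nat) x, A x -> derivable_on A (iter n (derive_on A) g) x.

Definition piecewise_smooth (alpha : R) g :=
  (exists2 gl : R -> V, smooth_on `[0, alpha]%classic gl &
                        {in `[0, alpha[, g =1 gl}) /\
  (exists2 gr : R -> V, smooth_on `[alpha, 1]%classic gr &
                        {in `]alpha, 1], g =1 gr}).

Definition jump g (alpha : R) : V :=
  lim (g x @[x --> alpha^'+]) - lim (g x @[x --> alpha^'-]).

(* Lipschitz continuity at the single point alpha. *)
Definition lipschitz_at g (alpha : R) :=
  exists L : R, \forall x \near alpha,
    `|g x - g alpha| <= L * `|x - alpha|.

End derivative_on_a_set.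

(* Used for finite-dimensional V, where this is the usual C^oo: every iterated
   directional derivative of g exists and is differentiable. *)
Definition smooth (R : realType) (V W : normedModType R) (g : V -> W) :=
  forall (vs : seq V) (x : V),
    differentiable (foldr (fun v (h : V -> W) => 'D_v h) g vs) x.

(* Vectors of R^d are row vectors. The library's 'J f x acts on the right of
   row vectors (v *m 'J f x = 'd f x v), so it is the transpose of the usual
   matrix f'(x) of the partial derivatives d f_i / d x_j, and the column
   f'(x)^T z is, as a row, z *m f'(x) = z *m ('J f x)^T. *)
Definition adj (R : realType) (d : nat) (f : 'rV[R]_d -> 'rV[R]_d)
  (x z : 'rV[R]_d) : 'rV[R]_d := z *m ('J f x)^T.

Definition grad (R : realType) (d : nat) (p : 'rV[R]_d -> R)
  (x : 'rV[R]_d) : 'rV[R]_d := \row_j 'D_(delta_mx 0 j) p x.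

Definition dot (R : realType) (d : nat) (u v : 'rV[R]_d) : R :=
  (u *m v^T) 0 0.

(* Main.v *)
Require Import Defs.
From HB Require Import structures.
From mathcomp Require Import all_boot all_order all_algebra.
From mathcomp Require Import all_classical all_reals all_analysis.
From mathcomp Require Import ring lra.

Set Implicit Arguments.
Unset Strict Implicit.
Unset Printing Implicit Defensive.
Import Order.TTheory GRing.Theory Num.Theory.
Import numFieldNormedType.Exports.
Local Open Scope classical_set_scope.
Local Open Scope ring_scope.

(* For fixed eps, write (w, z) for (w^eps, z^eps). The two equations make
     H(x) = z . S(w) - eps z_x . w_x - p(w)
   constant in x. Away from alpha the viscous term vanishes as eps -> 0, so
   z . S(w) - p(w) takes one and the same value at all interior points other
   than alpha. Letting x tend to alpha from both sides gives
   z(alpha) . [S(w)] = [p(w)], and [f(w)_x] = - [S(w)]. *)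

(** * Derivatives relative to a set *)

Section derivative_on_interior.
Context {R : realType} {V : normedModType R}.
Implicit Types (A : set R) (g : R -> V) (x : R).

(** At an interior point [A] contains a punctured neighbourhood of [x], so the restriction to [A]
    does not change the filter. The translation by [x] then gives the quotient that defines the
    directional derivative along [1]. *)
Lemma quotient_interior A g x : (interior A) x ->
  quotient g x @ within A x^' =
  (fun h : R => h^-1 *: ((g \o shift x) (h *: (1 : R)) - g x)) @ 0^'.
Proof.
move=> Ax.
have Ax' : x^' A by exact: nbhs_dnbhs.
rewrite (_ : within A x^' = x^'); last first.
  rewrite predeqE => P; split => [AP|]; last exact: (@filterS _ x^').
  by apply: (filterS2 _ _ Ax') AP => y Ay; apply.
apply/funext => P.
have -> : (quotient g x @ x^') P =
    (\forall y \near x, y != x -> P (quotient g x y)) by [].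
rewrite (near_shift 0 x) /= subr0.
have K h : quotient g x (h + x) = h^-1 *: ((g \o shift x) (h *: (1 : R)) - g x).
  by rewrite /quotient /= addrK [h *: 1]mulr1.
have E h : (h + x != x) = (h != 0) by rewrite -subr_eq0 addrK.
by congr (nbhs (0 : R) _); apply/funext => h /=; rewrite E K.
Qed.

Lemma derive_on_interior A g x : (interior A) x -> derive_on A g x = 'D_1 g x.
Proof. by move=> Ax; rewrite /derive_on quotient_interior. Qed.

Lemma is_derive_on A g x : (interior A) x -> derivable_on A g x ->
  is_derive x 1 g (derive_on A g x).
Proof.
move=> Ax; rewrite /derivable_on quotient_interior// => dg.
by rewrite derive_on_interior//; exact: derivableP.
Qed.

(** For [y != x], [g y] is [(y - x) *: quotient g x y + g x]; the first factor tends to [0] and the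
    quotient converges. *)
Lemma derivable_on_cvg A g x : derivable_on A g x -> g @ within A x^' --> g x.
Proof.
move=> dg.
have Fx : Filter (within A x^') by exact: within_filter.
have yx0 : y - x @[y --> within A x^'] --> (0 : R).
  apply: (@cvg_within_filter _ _ _ x^').
  apply: (@cvg_within_filter _ _ _ (nbhs x)).
  suff : y - x @[y --> x] --> x - x by rewrite subrr.
  by apply: cvgB; [exact: cvg_id|exact: cvg_cst].
have := cvgD (cvgZ yx0 dg) (cvg_cst (g x)).
rewrite scale0r add0r => /(_ Fx Fx Fx); apply: cvg_trans.
apply: near_eq_cvg.
suff : within A x^' (fun y => y != x).
  apply: filterS => y yx.
  by rewrite /quotient /= !fctE scalerA mulfV ?scale1r ?subrK// subr_eq0.
by apply: (cvg_within (F := x^')); exact: (nbhs_dnbhs_neq x).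
Qed.

End derivative_on_interior.

(** * Algebra, bounds, limits and product rule for the scalar product *)

Section dot_product.
Context {R : realType} {d : nat}.
Implicit Types u v : 'rV[R]_d.

Lemma dotE u v : dot u v = \sum_i u 0 i * v 0 i.
Proof. by rewrite /dot !mxE; apply: eq_bigr => i _; rewrite !mxE. Qed.

Lemma dotDl u1 u2 v : dot (u1 + u2) v = dot u1 v + dot u2 v.
Proof. by rewrite /dot mulmxDl !mxE. Qed.

Lemma dotC u v : dot u v = dot v u.
Proof. by rewrite !dotE; apply: eq_bigr => i _; rewrite mulrC. Qed.

Lemma dotDr u v1 v2 : dot u (v1 + v2) = dot u v1 + dot u v2.
Proof. by rewrite dotC dotDl !(dotC u). Qed.

Lemma dotNr u v : dot u (- v) = - dot u v.
Proof. by rewrite /dot linearN mulmxN !mxE. Qed.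

Lemma dotZl (a : R) u v : dot (a *: u) v = a * dot u v.
Proof. by rewrite /dot -scalemxAl !mxE. Qed.

Lemma dotZr (a : R) u v : dot u (a *: v) = a * dot u v.
Proof. by rewrite dotC dotZl dotC. Qed.

(** Moves a Jacobian across the pairing: for [J] equal to ['J f x], the factor [u *m J^T] is
    [adj f x u]. *)
Lemma dot_mulmx (J : 'M[R]_d) u v : dot u (v *m J) = dot (u *m J^T) v.
Proof. by rewrite /dot trmx_mul mulmxA. Qed.

Lemma coord_le_norm u i : `|u 0 i| <= `|u|.
Proof.
rewrite [leRHS]/Num.norm/= mx_normrE.
by apply: le_trans (le_bigmax _ _ (0, i)).
Qed.

(** The norm on row vectors is the maximum norm, so each of the [d] products is bounded separately;
    this is where the factor [d] comes from. *)
Lemma normr_dot_le u v : `|dot u v| <= d%:R * (`|u| * `|v|).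
Proof.
rewrite dotE (le_trans (ler_norm_sum _ _ _))//.
apply: (@le_trans _ _ (\sum_(i < d) `|u| * `|v|)).
  by apply: ler_sum => i _; rewrite normrM ler_pM// coord_le_norm.
by rewrite sumr_const card_ord mulr_natl.
Qed.

Lemma cvg_dot {T : Type} {F : set_system T} {FF : Filter F}
    (f g : T -> 'rV[R]_d) u v :
  f @ F --> u -> g @ F --> v -> dot (f x) (g x) @[x --> F] --> dot u v.
Proof.
have coord (h : T -> 'rV[R]_d) (a : 'rV[R]_d) i : h @ F --> a ->
    h x 0 i @[x --> F] --> a 0 i.
  move=> ha.
  apply: (@continuous_cvg _ _ _ F _ h (fun M : 'rV[R]_d => M 0 i) a) => //.
  exact: coord_continuous.
move=> fu gv; rewrite dotE.
under eq_fun do rewrite dotE.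
apply: cvg_big => [|i _]; first exact: add_continuous.
by apply: cvgM; exact: coord.
Qed.

Lemma is_derive_dot (x : R) (f g : R -> 'rV[R]_d) u v :
  is_derive x 1 f u -> is_derive x 1 g v ->
  is_derive x 1 (fun t => dot (f t) (g t)) (dot u (g x) + dot (f x) v).
Proof.
have coord (h : R -> 'rV[R]_d) a i :
    is_derive x 1 h a -> is_derive x 1 (fun t => h t 0 i) (a 0 i).
  move=> [dh <-]; apply: DeriveDef; first exact: (derivable_mxP _ _ _).1.
  by rewrite derive_mx// mxE.
move=> fu gv.
pose h i : R -> R := (fun t => f t 0 i) * (fun t => g t 0 i).
have -> : (fun t => dot (f t) (g t)) = \sum_(i < d) h i.
  by apply/funext => t; rewrite dotE fct_sumE; apply: eq_bigr.
have dh i : is_derive x 1 (h i) (f x 0 i *: v 0 i + g x 0 i *: u 0 i).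
  by apply: is_deriveM; exact: coord.
apply: (is_derive_eq (is_derive_sum dh)).
rewrite !dotE -big_split; apply: eq_bigr => i _ /=.
by rewrite addrC; congr (_ + _); rewrite [_ *: _]mulrC.
Qed.

End dot_product.

(** * Chain rule and the quantity conserved by the two viscous equations *)

Lemma is_derive_comp_diff (R : realType) (V W : normedModType R)
    (u : R -> V) (g : V -> W) (x : R) (a : V) :
  is_derive x 1 u a -> differentiable g (u x) ->
  is_derive x 1 (g \o u) ('d g (u x) a).
Proof.
move=> [du <-] dg; have dux : differentiable u x by exact/derivable1_diffP.
have dgu := differentiable_comp dux dg.
apply: DeriveDef; first exact/derivable1_diffP.
by rewrite !deriveE// diff_comp.
Qed.

Lemma diff_grad (R : realType) (d : nat) (p : 'rV[R]_d -> R) (x v : 'rV[R]_d) :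
  differentiable p x -> 'd p x v = dot (grad p x) v.
Proof.
move=> dp; rewrite dotE {1}(row_sum_delta v) linear_sum.
by apply: eq_bigr => i _; rewrite linearZ /= mxE deriveE// mulrC.
Qed.

Lemma jacobian_mul (R : realType) (m n : nat) (f : 'rV[R]_m -> 'rV[R]_n)
    (x v : 'rV[R]_m) : differentiable f x -> 'd f x v = v *m 'J f x.
Proof. by move=> df; rewrite -deriveE// deriveEjacobian. Qed.

(** The derivative is z1 . S + (S'^T z) . w1 - e (z2 . w1 + z1 . w2) - grad p . w1. The first
    equation gives S = e w2 - f' w1 and the second S'^T z = e z2 + grad p + f'^T z1; after
    substitution everything cancels, the f' terms by transposition. *)
Lemma is_derive_hamiltonian (R : realType) (d : nat)
    (f S : 'rV[R]_d -> 'rV[R]_d) (p : 'rV[R]_d -> R) (e : R)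
    (w z w1 z1 : R -> 'rV[R]_d) (x : R) (w2 z2 : 'rV[R]_d) :
  differentiable f (w x) -> differentiable S (w x) -> differentiable p (w x) ->
  is_derive x 1 w (w1 x) -> is_derive x 1 z (z1 x) ->
  is_derive x 1 w1 w2 -> is_derive x 1 z1 z2 ->
  'D_1 (f \o w) x + S (w x) = e *: w2 ->
  - adj f (w x) (z1 x) + adj S (w x) (z x) = e *: z2 + grad p (w x) ->
  is_derive x 1
    (fun t => dot (z t) (S (w t)) - e * dot (z1 t) (w1 t) - p (w t)) 0.
Proof.
move=> df dS dp dw dz dw1 dz1 w_eq z_eq.
have dfw := is_derive_comp_diff dw df.
have dSw := is_derive_comp_diff dw dS.
have dpw := is_derive_comp_diff dw dp.
apply: (is_derive_eq (is_deriveB (is_deriveB (is_derive_dot dz dSw)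
  (is_deriveZ e (is_derive_dot dz1 dw1))) dpw)).
rewrite (@derive_val _ _ _ _ _ _ _ dfw) jacobian_mul// in w_eq.
have SE : S (w x) = e *: w2 - w1 x *m 'J f (w x) by rewrite -w_eq addrC addKr.
have adjE : adj S (w x) (z x) =
    e *: z2 + grad p (w x) + adj f (w x) (z1 x) by rewrite -z_eq addrC addNKr.
rewrite /= (jacobian_mul _ dS) (diff_grad _ dp) [in dot (z x) _]dot_mulmx.
rewrite -/(adj S (w x) (z x)) adjE SE !(dotDl, dotDr, dotNr, dotZl, dotZr).
(* Both f' terms now have the form [dot (adj f (w x) (z1 x)) (w1 x)], with opposite signs. On [R]
   the scaling by [e] is multiplication, which [ring] can treat. *)
rewrite dot_mulmx -/(adj f (w x) (z1 x)) [_ *: _]mulrDr.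
ring.
Qed.

(** Mean value theorem on the segment between the two points, which stays inside the open
    interval. *)
Lemma derive0_cst (R : realType) (g : R -> R) (a b : R) :
  {in `]a, b[, forall x : R, is_derive x 1 g 0} ->
  {in `]a, b[ &, forall x y, g x = g y}.
Proof.
move=> dg; suff lt x y : x < y -> x \in `]a, b[ -> y \in `]a, b[ -> g x = g y.
  move=> x y xab yab; have [xy|yx|->//] := ltgtP x y; first exact: lt.
  by apply/esym; exact: lt.
move=> xy xab yab.
have sub t : t \in `[x, y] -> t \in `]a, b[.
  move: xab yab; rewrite !in_itv /= => /andP[ax _] /andP[_ yb] /andP[xt ty].
  by rewrite (lt_le_trans ax)// (le_lt_trans ty).
have dgxy t : t \in `]x, y[ -> is_derive t 1 g 0.
  by move=> txy; apply/dg/sub/subset_itv_oo_cc.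
have cg : {within `[x, y], continuous g}.
  by apply: derivable_within_continuous => t /sub /dg [].
have [c _] := MVT xy dgxy cg.
by rewrite mul0r => /eqP; rewrite subr_eq0 => /eqP.
Qed.

(** * One-sided limits and jumps *)

Section one_sided_limits.
Context {R : realType} {V : normedModType R}.
Implicit Types (g : R -> V) (a b : R).

(** Yields the trace of a piecewise smooth function from its extension [gl]; the value [g b] itself
    is left free. *)
Lemma cvg_at_left_itv g gl a b : a < b -> derivable_on `[a, b]%classic gl b ->
  {in `[a, b[, g =1 gl} -> g x @[x --> b^'-] --> gl b.
Proof.
move=> ab /derivable_on_cvg glb ggl; apply: cvg_trans glb.
(* Points just to the left of [b] lie in the segment and differ from [b], so the left filter refines
   the one along which [gl] converges. *)
suff H : b^'- `=>` within `[a, b]%classic b^'.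
  apply: (@cvg_trans _ (gl @ b^'-)); last exact: cvg_app.
  apply: near_eq_cvg; near=> x; apply/esym/ggl; rewrite in_itv /=.
  by apply/andP; split => //; near: x; exact: nbhs_left_ge.
move=> P Pb; have {Pb} : \forall x \near b, x != b -> `[a, b]%classic x -> P x by [].
move=> Pb; rewrite /at_left /within /=.
have : \forall x \near b, a < x by exact: lt_nbhsr.
apply: filter_app; apply: filterS Pb => x Px ax xb.
apply: Px; first by rewrite lt_eqF.
by rewrite /= in_itv /= !ltW.
Unshelve. all: by end_near. Qed.

Lemma cvg_at_right_itv g gr a b : a < b -> derivable_on `[a, b]%classic gr a ->
  {in `]a, b], g =1 gr} -> g x @[x --> a^'+] --> gr a.
Proof.
move=> ab /derivable_on_cvg gra ggr; apply: cvg_trans gra.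
suff H : a^'+ `=>` within `[a, b]%classic a^'.
  apply: (@cvg_trans _ (gr @ a^'+)); last exact: cvg_app.
  apply: near_eq_cvg; near=> x; apply/esym/ggr; rewrite in_itv /=.
  by apply/andP; split => //; near: x; exact: nbhs_right_le.
move=> P Pa; have {Pa} : \forall x \near a, x != a -> `[a, b]%classic x -> P x by [].
move=> Pa; rewrite /at_right /within /=.
have : \forall x \near a, x < b by exact: lt_nbhsl.
apply: filter_app; apply: filterS Pa => x Px xb ax.
apply: Px; first by rewrite gt_eqF.
by rewrite /= in_itv /= !ltW.
Unshelve. all: by end_near. Qed.

Lemma lipschitz_at_continuous g a : lipschitz_at g a -> {for a, continuous g}.
Proof.
move=> [L Lg]; apply/subr_cvg0/norm_cvg0P.
have cL : L * `|x - a| @[x --> a] --> (0 : R).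
  have xa0 : `|x - a| @[x --> a] --> (0 : R) by exact/norm_cvg0P/subr_cvg0.
  by have := cvgM (cvg_cst L) xa0; rewrite mulr0; exact.
apply: (squeeze_cvgr _ (cvg_cst 0) cL).
by apply: filterS Lg => x ->; rewrite normr_ge0.
Qed.

Lemma jumpE g a (l r : V) :
  g x @[x --> a^'-] --> l -> g x @[x --> a^'+] --> r -> jump g a = r - l.
Proof.
by move=> gl gr; rewrite /jump (cvg_lim _ gl)// (cvg_lim _ gr).
Qed.

End one_sided_limits.

(** * Smooth maps under limits, and the vanishing viscous term *)

Lemma smooth_differentiable (R : realType) (V W : normedModType R) (g : V -> W) x :
  smooth g -> differentiable g x.
Proof. by move=> gs; exact: (gs [::]). Qed.

Lemma smooth_continuous (R : realType) (V W : normedModType R) (g : V -> W) :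
  smooth g -> continuous g.
Proof. by move=> gs x; exact/differentiable_continuous/smooth_differentiable. Qed.

Lemma cvg_smooth_comp (R : realType) (V W : normedModType R) (g : V -> W)
    (T : Type) (F : set_system T) (FF : Filter F) (u : T -> V) (a : V) :
  smooth g -> u @ F --> a -> g (u t) @[t --> F] --> g a.
Proof.
move=> gs ua; apply: (@continuous_cvg _ _ _ F _ u g a) => //.
exact: smooth_continuous.
Qed.

Lemma interior_Omega (R : realType) (x : R) : x \in `]0, 1[ -> (interior Omega) x.
Proof.
move=> x01; apply: (filterS _ (near_in_itvoo x01)) => y.
exact: subset_itv_oo_cc.
Qed.

Lemma viscous_dot_cvg0 (R : realType) (d : nat) (C : R) (u v : R -> 'rV[R]_d) :
  (\forall e \near 0^'+, `|u e| <= C /\ `|v e| <= C) ->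
  e * dot (u e) (v e) @[e --> 0^'+] --> (0 : R).
Proof.
move=> bd.
(* The squeezing bound: [normr_dot_le] with both norms at most [C]. *)
have cK : `|e| * (d%:R * (C * C)) @[e --> (0 : R)^'+] --> (0 : R).
  apply: cvg_at_right_filter.
  have e0 : `|e| @[e --> (0 : R)] --> `|0 : R| by exact: cvg_norm.
  by have := cvgM e0 (cvg_cst (d%:R * (C * C))); rewrite normr0 mul0r; exact.
apply/norm_cvg0P; apply: (squeeze_cvgr _ (cvg_cst 0) cK).
apply: filterS bd => e [ub vb]; rewrite normr_ge0 /= normrM ler_wpM2l//.
by rewrite (le_trans (normr_dot_le _ _))// ler_wpM2l// ler_pM.
Qed.

(** * The interior boundary condition *)

Theorem corollary3p1 (R : realType) (d : nat)
  (f S : 'rV[R]_d -> 'rV[R]_d) (p : 'rV[R]_d -> R)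
  (f_smooth : smooth f) (S_smooth : smooth S) (p_smooth : smooth p)
  (alpha : R) (alpha01 : 0 < alpha < 1)
  (eps0 : R) (eps0_gt0 : 0 < eps0)
  (abar : R -> R)
  (abar_gt0 : forall e, 0 < e < eps0 -> 0 < abar e)
  (abar_cvg0 : abar e @[e --> 0^'+] --> 0)
  (weps zeps : R -> R -> 'rV[R]_d)
  (weps_smooth : forall e, 0 < e < eps0 -> smooth_on Omega (weps e))
  (zeps_smooth : forall e, 0 < e < eps0 -> smooth_on Omega (zeps e))
  (weps_eq : forall e, 0 < e < eps0 -> forall x, Omega x ->
     derive_on Omega (f \o weps e) x + S (weps e x) =
     e *: derive_on Omega (derive_on Omega (weps e)) x)
  (zeps_eq : forall e, 0 < e < eps0 -> forall x, Omega x ->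
     - adj f (weps e x) (derive_on Omega (zeps e) x) +
       adj S (weps e x) (zeps e x) =
     e *: derive_on Omega (derive_on Omega (zeps e)) x + grad p (weps e x))
  (bounded_outside : exists C : R, forall e, 0 < e < eps0 -> forall x,
     (Omega `\` `[alpha - abar e, alpha + abar e]%classic) x ->
     `|derive_on Omega (weps e) x| <= C /\ `|derive_on Omega (zeps e) x| <= C)
  (w z : R -> 'rV[R]_d)
  (w_psmooth : piecewise_smooth alpha w)
  (w_discontinuous : ~ continuous_at alpha w)
  (w_eq : forall x, (Omega `\ alpha) x ->
     derive_on Omega (f \o w) x + S (w x) = 0)
  (w_RH : jump (f \o w) alpha = 0)
  (z_derivable : forall x, (Omega `\ alpha) x -> derivable_on Omega z x)
  (z_eq : forall x, (Omega `\ alpha) x ->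
     - adj f (w x) (derive_on Omega z x) + adj S (w x) (z x) = grad p (w x))
  (z_lipschitz : lipschitz_at z alpha)
  (weps_cvg : forall x, (Omega `\ alpha) x -> weps e x @[e --> 0^'+] --> w x)
  (zeps_cvg : forall x, (Omega `\ alpha) x -> zeps e x @[e --> 0^'+] --> z x) :
  dot (z alpha) (jump (derive_on Omega (f \o w)) alpha) = - jump (p \o w) alpha.
Proof.
have [alpha_gt0 alpha_lt1] := andP alpha01.
have [[wl wl_smooth wlE] [wr wr_smooth wrE]] := w_psmooth.
(* The traces of [w] at [alpha]: order [0] of [smooth_on] is derivability of the extension at the
   endpoint [alpha]. *)
have w_cvgl : w x @[x --> alpha^'-] --> wl alpha.
  apply: (cvg_at_left_itv alpha_gt0) wlE; apply: (wl_smooth 0%N).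
  by rewrite /= in_itv /= lexx ltW.
have w_cvgr : w x @[x --> alpha^'+] --> wr alpha.
  apply: (cvg_at_right_itv alpha_lt1) wrE; apply: (wr_smooth 0%N).
  by rewrite /= in_itv /= lexx ltW.
have z_cont := lipschitz_at_continuous z_lipschitz.
have z_cvgl : z x @[x --> alpha^'-] --> z alpha by exact: cvg_at_left_filter.
have z_cvgr : z x @[x --> alpha^'+] --> z alpha by exact: cvg_at_right_filter.
(* Interior points, where [derive_on] is the usual derivative, away from [alpha], where the exact
   equation and the pointwise convergence are available. *)
pose punctured x := (x \in `]0, 1[) /\ x != alpha.
have punctured_Omega x : punctured x -> (Omega `\ alpha) x.
  by case=> /subset_itv_oo_cc x01 /eqP xa; split.
have nearl : \forall x \near alpha^'-, punctured x.
  near=> x; split; last by rewrite lt_eqF//; near: x; exact: nbhs_left_lt.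
  rewrite in_itv /=; apply/andP; split; first by near: x; exact: nbhs_left_gt.
  by rewrite (lt_trans _ alpha_lt1)//; near: x; exact: nbhs_left_lt.
have nearr : \forall x \near alpha^'+, punctured x.
  near=> x; split; last by rewrite gt_eqF//; near: x; exact: nbhs_right_gt.
  rewrite in_itv /=; apply/andP; split; last by near: x; exact: nbhs_right_lt.
  by rewrite (lt_trans alpha_gt0)//; near: x; exact: nbhs_right_gt.
pose H e x := dot (zeps e x) (S (weps e x)) -
  e * dot (derive_on Omega (zeps e) x) (derive_on Omega (weps e) x) -
  p (weps e x).
pose K x := dot (z x) (S (w x)) - p (w x).
have H_cst e : 0 < e < eps0 -> {in `]0, 1[ &, forall x y, H e x = H e y}.
  move=> ee; apply: derive0_cst => x x01.
  have ix := interior_Omega x01; have Ox := interior_subset ix.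
  have [ws zs] := (weps_smooth e ee, zeps_smooth e ee).
  apply: (@is_derive_hamiltonian R d f S p e (weps e) (zeps e)
    (derive_on Omega (weps e)) (derive_on Omega (zeps e)) x
    (derive_on Omega (derive_on Omega (weps e)) x)
    (derive_on Omega (derive_on Omega (zeps e)) x));
    try exact: smooth_differentiable.
  (* Orders [0] and [1] of smoothness differentiate the functions and their first derivatives. *)
  - exact: is_derive_on ix (ws 0%N x Ox).
  - exact: is_derive_on ix (zs 0%N x Ox).
  - exact: is_derive_on ix (ws 1%N x Ox).
  - exact: is_derive_on ix (zs 1%N x Ox).
  - by rewrite -(derive_on_interior _ ix); exact: weps_eq.
  - exact: zeps_eq.
have e_near : \forall e \near (0 : R)^'+, 0 < e < eps0.
  near=> e; apply/andP; split; near: e; first exact: nbhs_right_gt.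
  exact: nbhs_right_lt.
have H_cvg x : punctured x -> H e x @[e --> 0^'+] --> K x.
  move=> px; have Ox := punctured_Omega _ px.
  have visc : e * dot (derive_on Omega (zeps e) x) (derive_on Omega (weps e) x)
      @[e --> 0^'+] --> (0 : R).
    have [C bd] := bounded_outside.
    apply: (@viscous_dot_cvg0 _ _ C).
    (* A fixed [x != alpha] leaves the shrinking transition region as soon as [abar e] is below its
       distance to [alpha]; from then on the uniform bound [C] applies at [x]. *)
    have xa0 : 0 < `|x - alpha| by rewrite normr_gt0 subr_eq0; case: px.
    have /cvgr0_norm_lt/(_ _ xa0) abar_lt := abar_cvg0.
    near=> e.
    have ee : 0 < e < eps0 by near: e.
    have ae : `|abar e| < `|x - alpha| by near: e.
    suff /(bd e ee) [] :
      (Omega `\` `[alpha - abar e, alpha + abar e]%classic) x by split.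
    split; first by case: Ox.
    rewrite /= in_itv /= -ler_distl; apply/negP; rewrite -ltNge.
    exact: le_lt_trans (ler_norm _) ae.
  rewrite /K -[X in X - p _]subr0.
  apply: cvgB; last exact: cvg_smooth_comp (weps_cvg _ Ox).
  apply: cvgB => //; apply: cvg_dot; first exact: zeps_cvg.
  exact: cvg_smooth_comp (weps_cvg _ Ox).
have K_cst x y : punctured x -> punctured y -> K x = K y.
  move=> px py.
  (* [H e x = H e y] for all small [e], even with [alpha] between [x] and [y], since [H e] is smooth
     across the transition region; so the limits [K x] and [K y] agree. *)
  apply: (@cvg_unique _ (@norm_hausdorff _ R) (H e y @[e --> (0 : R)^'+])).
    apply: cvg_trans (H_cvg _ px); apply: near_eq_cvg.
    near=> e; apply: H_cst; [by near: e|by case: px|by case: py].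
  exact: H_cvg.
have Kl : K x @[x --> alpha^'-] --> dot (z alpha) (S (wl alpha)) - p (wl alpha).
  by apply: cvgB; [apply: cvg_dot => //|]; exact: cvg_smooth_comp.
have Kr : K x @[x --> alpha^'+] --> dot (z alpha) (S (wr alpha)) - p (wr alpha).
  by apply: cvgB; [apply: cvg_dot => //|]; exact: cvg_smooth_comp.
have K_eq : dot (z alpha) (S (wl alpha)) - p (wl alpha) =
            dot (z alpha) (S (wr alpha)) - p (wr alpha).
  (* Any reference point [y] serves: [K] equals [K y] on both sides of [alpha], hence so do both
     one-sided limits. *)
  have [y py] := filter_ex nearl.
  have lim_eq (F : set_system R) (l : R) : ProperFilter F ->
      (\forall x \near F, punctured x) -> K x @[x --> F] --> l -> l = K y.
    move=> FF Fp Fl; suff KF : K x @[x --> F] --> K y by exact: cvg_unique Fl KF.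
    apply: (@cvg_trans _ (fmap (cst (K y)) F)); last exact: cvg_cst.
    by apply: near_eq_cvg; apply: filterS Fp => x px; exact: K_cst.
  by rewrite (lim_eq _ _ _ nearl Kl) (lim_eq _ _ _ nearr Kr).
(* The exact equation reads f(w)_x = - S(w) away from [alpha]; stated for a general filter, it
   serves both sides. *)
have fw_cvg (F : set_system R) (l : 'rV[R]_d) : Filter F ->
    (\forall x \near F, punctured x) -> w @ F --> l ->
    derive_on Omega (f \o w) x @[x --> F] --> - S l.
  move=> FF Fp Fl; apply: (@cvg_trans _ (- S (w x) @[x --> F])).
    apply: near_eq_cvg; apply: filterS Fp => x px.
    by apply/esym/eqP; rewrite -addr_eq0 w_eq//; exact: punctured_Omega.
  by apply: cvgN; exact: cvg_smooth_comp.
rewrite (jumpE (fw_cvg _ _ _ nearl w_cvgl) (fw_cvg _ _ _ nearr w_cvgr)).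
rewrite (@jumpE _ _ (p \o w) _ _ _ (cvg_smooth_comp _ p_smooth w_cvgl)
  (cvg_smooth_comp _ p_smooth w_cvgr)).
(* The goal is now a linear rearrangement of [K_eq]. *)
rewrite dotDr !dotNr; lra.
Unshelve. all: by end_near. Qed.
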